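(* Let $n,T\ge 1$ and let $A_1,\dots,A_T\in\mathbb{R}^{n\times n}$ be symmetric matrices that share a common full set of orthonormal eigenvectors $v_1,\dots,v_n$ (i.e. $v_1,\dots,v_n$ is an orthonormal basis of $\mathbb{R}^n$ and each $v_i$ is an eigenvector of every $A_t$), and all of whose eigenvalues lie in $[-1,1]$. Let $\mu\in(0,1/6]$ and let $z_1,\dots,z_T$ be the unit vectors produced by Oja's algorithm with step-size $\mu$ on the input sequence $A_1,\dots,A_T$, started from a unit vector $w_1=z_1$. Then for every $i\in\{1,\dots,n\}$, $$\sum_{t=1}^T\left(v_i^{\top}A_tv_i-z_t^{\top}A_tz_t\right)\le \mu\sum_{t=1}^T\left(3\left|v_i^{\top}A_tv_i\right|+\frac12\Vert A_t\Vert_2^2\right)-\frac{\ln\left((z_1^{\top}v_i)^2\right)}{2\mu},$$ where the right-hand side is interpreted as $+\infty$ if $z_1^{\top}v_i=0$.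
   Context: Oja's algorithm with step-size $\mu\ge 0$ on a sequence of real symmetric $n\times n$ matrices $A_1,A_2,\dots$: start with a (random) unit vector $w_1\in\mathbb{R}^n$; for $t=1,2,\dots$ set $z_t=w_t/\Vert w_t\Vert_2$ and $w_{t+1}=(I+\mu A_t)w_t$. For matrices $\Vert\cdot\Vert_2$ is the spectral norm; for vectors it is the Euclidean norm. $\ln$ is the natural logarithm. The inequality is asserted for every realization of the initial vector. *)

(* Defs.v *)
From HB Require Import structures.
From mathcomp Require Import all_boot all_order all_algebra.
From mathcomp Require Import all_classical all_reals all_analysis.

Set Implicit Arguments.
Unset Strict Implicit.
Unset Printing Implicit Defensive.

Import Order.TTheory GRing.Theory Num.Theory.

Local Open Scope classical_set_scope.
Local Open Scope ring_scope.

Definition dotv (R : realType) (n : nat) (x y : 'cV[R]_n) : R :=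
  (x^T *m y) 0 0.

Definition quadf (R : realType) (n : nat) (A : 'M[R]_n) (x : 'cV[R]_n) : R :=
  (x^T *m A *m x) 0 0.

(* The library's norm `|x| on matrices is the sup norm of the entries. *)
Definition norm2 (R : realType) (n : nat) (x : 'cV[R]_n) : R :=
  Num.sqrt (\sum_(i < n) x i 0 ^+ 2).

(* The supremum of a nonempty set that is bounded above, so never the default
   value of sup. *)
Definition spectral_norm (R : realType) (n : nat) (A : 'M[R]_n) : R :=
  sup [set norm2 (A *m x) | x in [set x : 'cV[R]_n | norm2 x <= 1]].

(* An orthonormal family of n vectors in dimension n automatically spans. *)
Definition orthonormal_basis (R : realType) (n : nat) (v : 'I_n -> 'cV[R]_n)
  : Prop :=
  forall i j, dotv (v i) (v j) = (i == j)%:R.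

Definition eigenvector (R : realType) (n : nat) (A : 'M[R]_n) (x : 'cV[R]_n)
  : Prop :=
  x != 0 /\ exists l : R, A *m x = l *: x.

(* The time index t starts at 1, for the matrices A t as well as for the
   iterates; A 0 is never used and the value at t = 0 is a dummy. *)
Fixpoint oja_w (R : realType) (n : nat) (mu : R) (A : nat -> 'M[R]_n)
    (w1 : 'cV[R]_n) (t : nat) : 'cV[R]_n :=
  match t with
  | 0 => w1
  | s.+1 => if s is 0 then w1 else (1%:M + mu *: A s) *m oja_w mu A w1 s
  end.

Definition oja_z (R : realType) (n : nat) (mu : R) (A : nat -> 'M[R]_n)
    (w1 : 'cV[R]_n) (t : nat) : 'cV[R]_n :=
  (norm2 (oja_w mu A w1 t))^-1 *: oja_w mu A w1 t.

(* Main.v *)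
Require Import Defs.
From HB Require Import structures.
From mathcomp Require Import all_boot all_order all_algebra.
From mathcomp Require Import all_classical all_reals all_analysis.
From mathcomp Require Import ring lra.

(* The potential ln((z_t . v_i)^2) is nonpositive, and equals ln((z_1 . v_i)^2)
   at time 1. Writing l = v_i . A_t v_i, the inner product w_t . v_i is
   multiplied by 1 + mu l at step t, while the squared norm of w_t is multiplied
   by 1 + 2 mu (z_t . A_t z_t) + mu^2 |A_t z_t|^2. Hence ln(1+x) >= x - 3x^2 and
   ln(1+x) <= x show that the potential grows by at least
   2 mu (l - z_t . A_t z_t) - 6 mu^2 l^2 - mu^2 |A_t z_t|^2, and summing over t
   gives the regret bound because l^2 <= |l|. *)

Set Implicit Arguments.
Unset Strict Implicit.
Unset Printing Implicit Defensive.

Import Order.TTheory GRing.Theory Num.Theory.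

Local Open Scope ring_scope.

Section InnerProduct.
Variables (R : realType) (n : nat).
Implicit Types (x y z : 'cV[R]_n) (A : 'M[R]_n) (a : R).

Lemma dotvC x y : dotv x y = dotv y x.
Proof. by rewrite /dotv !mxE; apply: eq_bigr => i _; rewrite !mxE mulrC. Qed.

Lemma dotvDl x y z : dotv (x + y) z = dotv x z + dotv y z.
Proof. by rewrite /dotv linearD mulmxDl mxE. Qed.

Lemma dotvZl a x y : dotv (a *: x) y = a * dotv x y.
Proof. by rewrite /dotv linearZ -scalemxAl mxE. Qed.

Lemma dotvDr x y z : dotv x (y + z) = dotv x y + dotv x z.
Proof. by rewrite dotvC dotvDl !(dotvC x). Qed.

Lemma dotvZr a x y : dotv x (a *: y) = a * dotv x y.
Proof. by rewrite dotvC dotvZl dotvC. Qed.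

Lemma dotv_mulmxr A x : dotv x (A *m x) = quadf A x.
Proof. by rewrite /dotv /quadf mulmxA. Qed.

Lemma dotv_mulmxC A x y : A^T = A -> dotv (A *m x) y = dotv x (A *m y).
Proof. by move=> As; rewrite /dotv trmx_mul As mulmxA. Qed.

Lemma dotvv x : dotv x x = \sum_(i < n) x i 0 ^+ 2.
Proof. by rewrite /dotv mxE; apply: eq_bigr => i _; rewrite mxE expr2. Qed.

Lemma dotvv_ge0 x : 0 <= dotv x x.
Proof. by rewrite dotvv sumr_ge0// => i _; rewrite sqr_ge0. Qed.

Lemma norm2E x : norm2 x = Num.sqrt (dotv x x).
Proof. by rewrite dotvv. Qed.

Lemma sqr_norm2 x : norm2 x ^+ 2 = dotv x x.
Proof. by rewrite norm2E sqr_sqrtr// dotvv_ge0. Qed.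

Lemma norm2_ge0 x : 0 <= norm2 x.
Proof. exact: sqrtr_ge0. Qed.

Lemma norm2Z a x : norm2 (a *: x) = `|a| * norm2 x.
Proof.
by rewrite !norm2E dotvZl dotvZr mulrA -expr2 sqrtrM ?sqr_ge0// sqrtr_sqr.
Qed.

(** Cauchy-Schwarz for a unit vector [y]: the residual of [x] after projection onto [y] has squared
    norm [dotv x x - dotv x y ^+ 2]. *)
Lemma dotv_unit_le x y : dotv y y = 1 -> dotv x y ^+ 2 <= dotv x x.
Proof.
move=> y1; have := dotvv_ge0 (x + - dotv x y *: y).
rewrite !(dotvDl, dotvDr, dotvZl, dotvZr) y1 (dotvC y x); nra.
Qed.

(** A crude bound, uniform over the unit ball since every entry of [x] has absolute value at most 1.
    It serves to show that the set under [sup] in [spectral_norm] is bounded above. *)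
Lemma norm2_mulmx_le A x :
  norm2 x <= 1 -> norm2 (A *m x) ^+ 2 <= \sum_i (\sum_j `|A i j|) ^+ 2.
Proof.
move=> x1; have x1' : dotv x x <= 1.
  by rewrite -sqr_norm2 expr_le1// norm2_ge0.
rewrite sqr_norm2 dotvv ler_sum// => i _.
rewrite -(real_normK (num_real ((A *m x) i 0))) lerXn2r ?nnegrE ?sumr_ge0//.
rewrite mxE (le_trans (ler_norm_sum _ _ _))// ler_sum// => j _.
rewrite normrM ler_piMr//.
rewrite -(@expr_le1 _ 2)// real_normK ?num_real// (le_trans _ x1')// dotvv (bigD1 j)//=.
by rewrite lerDl sumr_ge0// => k _; rewrite sqr_ge0.
Qed.

Lemma norm2_mulmx_le_spectral A x :
  norm2 x <= 1 -> norm2 (A *m x) <= spectral_norm A.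
Proof.
move=> x1; apply: ub_le_sup; last by exists x.
exists (Num.sqrt (\sum_i (\sum_j `|A i j|) ^+ 2)) => _ [y /= y1 <-].
by rewrite -[leLHS]ger0_norm ?norm2_ge0// -sqrtr_sqr ler_wsqrtr// norm2_mulmx_le.
Qed.

End InnerProduct.

Definition normalize (R : realType) (n : nat) (x : 'cV[R]_n) : 'cV[R]_n :=
  (norm2 x)^-1 *: x.

Lemma normalizeZ (R : realType) (n : nat) (a : R) (x : 'cV[R]_n) :
  0 < a -> normalize (a *: x) = normalize x.
Proof.
move=> a0; rewrite /normalize norm2Z gtr0_norm// scalerA invfM mulrAC.
by rewrite mulVf ?gt_eqF// mul1r.
Qed.

Lemma norm2_normalize (R : realType) (n : nat) (x : 'cV[R]_n) :
  norm2 x != 0 -> norm2 (normalize x) = 1.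
Proof.
by move=> x0; rewrite norm2Z ger0_norm ?invr_ge0 ?norm2_ge0// mulVf.
Qed.

(** Applying [ln (1 + y) <= y] with [1 + y] the inverse of [1 + x] gives
    [ln (1 + x) >= x / (1 + x)], which exceeds [x - 3 * x ^+ 2] by
    [x ^+ 2 * (2 + 3 * x) / (1 + x)]. *)
Lemma ln1D_ge (R : realType) (x : R) :
  `|x| <= 1 / 6 -> x - 3 * x ^+ 2 <= ln (1 + x).
Proof.
rewrite ler_norml => /andP[x1 x2].
have x0 : 0 < 1 + x by lra.
have : ln (1 + ((1 + x)^-1 - 1)) <= (1 + x)^-1 - 1.
  by apply: le_ln1Dx; rewrite ltrBrDr addNr invr_gt0.
rewrite addrC subrK lnV ?posrE// lerNl; apply: le_trans.
rewrite -subr_ge0.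
have -> : - ((1 + x)^-1 - 1) - (x - 3 * x ^+ 2) = x ^+ 2 * (2 + 3 * x) / (1 + x).
  by field; rewrite gt_eqF.
by rewrite divr_ge0 ?(ltW x0)// mulr_ge0 ?sqr_ge0//; lra.
Qed.

(** The first two conclusions restore the hypotheses on [z], so that the step can be iterated; a
    nonzero inner product keeps [ln] away from its default value at 0. *)
Lemma oja_step (R : realType) (n : nat) (A : 'M[R]_n) (v z : 'cV[R]_n)
    (mu l : R) :
  A^T = A -> A *m v = l *: v -> `|l| <= 1 -> 0 < mu -> mu <= 1 / 6 ->
  norm2 v = 1 -> norm2 z = 1 -> dotv z v != 0 ->
  let z' := normalize ((1%:M + mu *: A) *m z) in
  [/\ norm2 z' = 1, dotv z' v != 0 &
    2 * mu * (l - quadf A z) <=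
    2 * mu ^+ 2 * (3 * `|l| + 1 / 2 * spectral_norm A ^+ 2)
    + ln (dotv z' v ^+ 2) - ln (dotv z v ^+ 2)].
Proof.
move=> As Av l1 mu0 mu6 v1 z1 zv; set u := (_ *m z) => /=.
have vv : dotv v v = 1 by rewrite -sqr_norm2 v1 expr1n.
have zz : dotv z z = 1 by rewrite -sqr_norm2 z1 expr1n.
have mul6 : `|mu * l| <= 1 / 6 by rewrite normrM gtr0_norm//; nra.
have mul_gt0 : 0 < 1 + mu * l by move: mul6; rewrite ler_norml; lra.
have uE : u = z + mu *: (A *m z) by rewrite /u mulmxDl mul1mx -scalemxAl.
have uv : dotv u v = (1 + mu * l) * dotv z v.
  by rewrite uE dotvDl dotvZl dotv_mulmxC// Av dotvZr; ring.
have uv0 : dotv u v != 0 by rewrite uv mulf_neq0// gt_eqF.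
(* By Cauchy-Schwarz, the nonzero component of [u] along [v] forces [u] to be nonzero, so it can be
   normalized. *)
have uu0 : 0 < dotv u u.
  by apply: lt_le_trans (dotv_unit_le u vv); rewrite exprn_even_gt0.
have nu0 : norm2 u != 0 by rewrite -sqrf_eq0 sqr_norm2 gt_eqF.
have uu : dotv u u = 1 + (2 * mu * quadf A z + mu ^+ 2 * norm2 (A *m z) ^+ 2).
  rewrite sqr_norm2 uE !(dotvDl, dotvDr, dotvZl, dotvZr) zz.
  by rewrite (dotvC (A *m z) z) dotv_mulmxr; ring.
have zv' : dotv (normalize u) v = dotv u v / norm2 u.
  by rewrite dotvZl mulrC.
split; first exact: norm2_normalize.
  by rewrite zv' mulf_neq0 ?invr_eq0.
rewrite zv' expr_div_n sqr_norm2 uv exprMn.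
have mul2_gt0 : (1 + mu * l) ^+ 2 \is Num.pos by rewrite posrE exprn_gt0.
have zv2_gt0 : dotv z v ^+ 2 \is Num.pos by rewrite posrE exprn_even_gt0.
rewrite ln_div ?posrE//; last exact: mulr_gt0.
rewrite lnM// (lnXn _ mul_gt0).
have Uu : ln (dotv u u) <= 2 * mu * quadf A z + mu ^+ 2 * norm2 (A *m z) ^+ 2.
  by rewrite uu le_ln1Dx//; move: uu0; rewrite uu; lra.
have NS : norm2 (A *m z) ^+ 2 <= spectral_norm A ^+ 2.
  have N0 := norm2_ge0 (A *m z).
  have NS : norm2 (A *m z) <= spectral_norm A.
    by rewrite norm2_mulmx_le_spectral// z1.
  by rewrite lerXn2r// nnegrE// (le_trans N0).
have := ln1D_ge mul6; rewrite -(mulr_natl (ln (1 + _))).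
have l2 : l ^+ 2 <= `|l| by rewrite -real_normK ?num_real// expr2 ler_piMr.
have := ler_wpM2l (sqr_ge0 mu) l2; have := ler_wpM2l (sqr_ge0 mu) NS.
rewrite exprMn; lra.
Qed.

(* MathComp-Analysis. The library logarithm lne on extended reals satisfies
   lne 0 = -oo, so the right-hand side is +oo when z_1^T v_i = 0. *)
Theorem theorem2 (R : realType) (n T : nat) (A : nat -> 'M[R]_n)
    (v : 'I_n -> 'cV[R]_n) (mu : R) (w1 : 'cV[R]_n)
    (n_ge1 : (1 <= n)%N) (T_ge1 : (1 <= T)%N)
    (A_sym : forall t, (1 <= t <= T)%N -> (A t)^T = A t)
    (v_basis : orthonormal_basis v)
    (v_eigen : forall t i, (1 <= t <= T)%N -> eigenvector (A t) (v i))
    (A_spec : forall t (l : R), (1 <= t <= T)%N ->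
       eigenvalue (A t) l -> -1 <= l <= 1)
    (mu_gt0 : 0 < mu) (mu_le : mu <= 1 / 6)
    (w1_unit : norm2 w1 = 1) (i : 'I_n) :
  let z := oja_z mu A w1 in
  ((\sum_(1 <= t < T.+1) (quadf (A t) (v i) - quadf (A t) (z t)))%:E <=
   (mu * \sum_(1 <= t < T.+1)
      (3 * `|quadf (A t) (v i)| + 1 / 2 * spectral_norm (A t) ^+ 2))%:E
   - lne (dotv (z 1%N) (v i) ^+ 2)%:E / (2 * mu)%:E)%E.
Proof.
cbv zeta; set z := oja_z mu A w1.
have z1E : z 1%N = w1 by rewrite /z /oja_z /= w1_unit invr1 scale1r.
have mu2 : 0 < 2 * mu by rewrite mulr_gt0.
have [zv0|zv0] := eqVneq (dotv (z 1%N) (v i)) 0.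
  by rewrite zv0 expr0n le0_lneNy// inver gt_eqF// gt0_mulNye ?lte_fin ?invr_gt0// leey.
have v1 : norm2 (v i) = 1 by rewrite norm2E v_basis eqxx sqrtr1.
have eigen t : (1 <= t <= T)%N ->
    A t *m v i = quadf (A t) (v i) *: v i /\ `|quadf (A t) (v i)| <= 1.
  move=> tT; have [vi0 [l Av]] := v_eigen t i tT.
  have -> : quadf (A t) (v i) = l.
    by rewrite -dotv_mulmxr Av dotvZr v_basis eqxx mulr1.
  split=> //; rewrite ler_norml; apply: (A_spec t) => //.
  (* [eigenvalue] refers to row vectors acting from the left, so the eigenvector is transposed and
     the symmetry of [A t] is used. *)
  apply/eigenvalueP; exists (v i)^T; last by rewrite trmx_eq0.
  by rewrite -{1}(A_sym t tT) -trmx_mul Av linearZ.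
(* [z t] is a positive multiple of the unnormalized iterate, and normalization ignores such factors.
   The iterate is nonzero, as otherwise [z t] would be zero, not a unit vector. *)
have z_unit_step t : (1 <= t)%N -> norm2 (z t) = 1 ->
    z t.+1 = normalize ((1%:M + mu *: A t) *m z t).
  case: t => [//|t] _ zt1; rewrite /z /oja_z -scalemxAr normalizeZ//.
  rewrite invr_gt0 lt_neqAle norm2_ge0 andbT eq_sym; apply/eqP => w0.
  by move: zt1; rewrite /z /oja_z w0 invr0 scale0r norm2E -(scale0r 0) dotvZl
    mul0r sqrtr0 => /eqP; rewrite eq_sym oner_eq0.
(* The one-step bounds telescope: [k] steps lead from [z 1] to [z k.+1]. For [k = 0] both sums are
   empty and the logarithms cancel. *)
have potential k : (k <= T)%N ->
  [/\ norm2 (z k.+1) = 1, dotv (z k.+1) (v i) != 0 &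
    2 * mu * (\sum_(1 <= t < k.+1) (quadf (A t) (v i) - quadf (A t) (z t))) <=
    2 * mu ^+ 2 * (\sum_(1 <= t < k.+1)
      (3 * `|quadf (A t) (v i)| + 1 / 2 * spectral_norm (A t) ^+ 2))
    + ln (dotv (z k.+1) (v i) ^+ 2) - ln (dotv (z 1%N) (v i) ^+ 2)].
  elim: k => [|k IHk] kT.
    by rewrite !big_geq// !mulr0 add0r subrr z1E -{2}z1E.
  have [zk1 zkv0 le_k] := IHk (ltnW kT).
  have kT' : (1 <= k.+1 <= T)%N by [].
  have [Av l1] := eigen _ kT'.
  have [] := oja_step (A_sym _ kT') Av l1 mu_gt0 mu_le v1 zk1 zkv0.
  rewrite -z_unit_step// => zk1' zkv0' step; split=> //.
  by rewrite !(@big_nat_recr _ _ _ k.+1)//= !mulrDr; move: step le_k; lra.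
have [zT1 zTv0 le_T] := potential T (leqnn T).
have ln_le0 : ln (dotv (z T.+1) (v i) ^+ 2) <= 0.
  apply: ln_le0; rewrite -(expr1n _ 2) -zT1 sqr_norm2 dotv_unit_le//.
  by rewrite v_basis eqxx.
rewrite lne_EFin ?exprn_even_gt0// inver gt_eqF// -EFinM -EFinB lee_fin.
rewrite -(ler_pM2l mu2) mulrBr [X in _ - X]mulrC divfK ?gt_eqF//.
by move: le_T; rewrite expr2 !mulrA; lra.
Qed.
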